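(* There exist absolute constants $C,C'>0$ such that the following holds. Let $X\in\mathbb R^{n\times d}$ be a deterministic matrix and let $\boldsymbol\eta$ be a random vector in $\mathbb R^n$ with mutually independent, symmetrically distributed entries, and let $\alpha=\min_{i\in[n]}\Pr\{|\boldsymbol\eta_i|\le1\}>0$. Let $\rho\in(0,1)$, $\delta\in(0,1)$, and suppose the column span of $X$ is $(m,\rho)$-spread for \[ m=C\cdot\frac{d\ln(10/\rho)+\ln(2/\delta)}{\rho^4\alpha^2}.\] Then with probability at least $1-\delta$ over $\boldsymbol\eta$, simultaneously for every $\beta^*\in\mathbb R^d$: with $\mathbf y=X\beta^*+\boldsymbol\eta$, every minimizer $\hat\beta$ of the Huber loss $f(\beta)=\frac1n\sum_{i=1}^n\Phi\big((X\beta-\mathbf y)_i\big)$ satisfies \[\tfrac1n\|X(\beta^*-\hat\beta)\|^2\le C'\cdot\frac{d+\ln(2/\delta)}{\rho^4\alpha^2 n}.\]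
   Context: The Huber penalty is $\Phi(t)=\tfrac12t^2$ if $|t|\le2$ and $\Phi(t)=2|t|-2$ otherwise. A random variable $Z$ is symmetrically distributed if $Z$ and $-Z$ have the same law. A linear subspace $V\subseteq\mathbb R^n$ is $(m,\rho)$-spread if for every $v\in V$ and every $S\subseteq[n]$ with $|S|\ge n-m$ one has $\|v_S\|\ge\rho\|v\|$, where $v_S$ is the restriction of $v$ to the coordinates in $S$. *)

(* Defs.v *)
From HB Require Import structures.
From mathcomp Require Import all_boot all_order all_algebra.
From mathcomp Require Import all_classical all_reals all_analysis.
Set Implicit Arguments. Unset Strict Implicit. Unset Printing Implicit Defensive.
Import Order.TTheory GRing.Theory Num.Theory.
Local Open Scope classical_set_scope.
Local Open Scope ring_scope.

Definition huber {R : realType} (t : R) : R :=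
  if `|t| <= 2 then t ^+ 2 / 2 else 2 * `|t| - 2.

Definition norm2 {R : realType} {n : nat} (v : 'cV[R]_n) : R :=
  Num.sqrt (\sum_(i < n) v i 0 ^+ 2).

Definition norm2_on {R : realType} {n : nat} (S : {set 'I_n}) (v : 'cV[R]_n) : R :=
  Num.sqrt (\sum_(i in S) v i 0 ^+ 2).

Definition colspan {R : realType} {n d : nat} (X : 'M[R]_(n, d)) : set 'cV[R]_n :=
  [set v | exists b : 'cV[R]_d, v = X *m b].

Definition spread {R : realType} {n : nat} (V : set 'cV[R]_n) (m rho : R) : Prop :=
  forall v, V v -> forall S : {set 'I_n},
    n%:R - m <= (#|S|)%:R -> rho * norm2 v <= norm2_on S v.

Definition huber_loss {R : realType} {n d : nat} (X : 'M[R]_(n, d))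
    (y : 'cV[R]_n) (beta : 'cV[R]_d) : R :=
  n%:R^-1 * \sum_(i < n) huber ((X *m beta - y) i 0).

Definition is_minimizer {R : realType} {n d : nat} (X : 'M[R]_(n, d))
    (y : 'cV[R]_n) (b : 'cV[R]_d) : Prop :=
  forall beta, huber_loss X y b <= huber_loss X y beta.

Definition mutually_independent {R : realType} {dT : measure_display}
    {T : measurableType dT} (P : probability T R) {n : nat}
    (eta : 'I_n -> T -> R) : Prop :=
  forall (S : {set 'I_n}) (A : 'I_n -> set R),
    (forall i, measurable (A i)) ->
    P (\bigcap_(i in [set j | j \in S]) (eta i @^-1` A i)) =
    (\prod_(i in S) P (eta i @^-1` A i))%E.

Definition symmetric_rv {R : realType} {dT : measure_display}
    {T : measurableType dT} (P : probability T R) (Z : T -> R) : Prop :=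
  forall A : set R, measurable A ->
    P (Z @^-1` A) = P ((fun w => - Z w) @^-1` A).

(* Main.v *)
Require Import Defs.
From HB Require Import structures.
From mathcomp Require Import all_boot all_order all_algebra.
From mathcomp Require Import all_classical all_reals all_analysis.
From mathcomp Require Import ring lra.
Set Implicit Arguments. Unset Strict Implicit. Unset Printing Implicit Defensive.
Import Order.TTheory GRing.Theory Num.Theory.
Local Open Scope classical_set_scope.
Local Open Scope ring_scope.

(** Let [phi = clamp 2] be the derivative of the Huber penalty, let
    [U = X (beta_hat - beta_star)], and suppose [|U| > r], where [r^2] is the
    claimed bound times [n].  Convexity, and strong convexity near the inliers
    ([|eta_i| <= 1]), give for [u = (r / |U|) U]
      [sum_(i inlier) min (|u_i|, 1)^2 / 2 <= <phi (eta), u>],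
    and this is contradicted by two events of probability [>= 1 - delta / 2]:
    - [<phi (eta), u> <= O (sqrt (d + ln (2 / delta))) |u|] on the column span
      (Hoeffding for symmetric variables and a net of constant precision);
    - [sum_(i inlier) min (|u_i|, 1)^2 >= alpha rho^2 r^2 / 64] for all [u] of
      norm [r].  For fixed [u], spreadness leaves a fraction [rho^2] of the mass
      on the coordinates with [u_i^2 <= r^2 / m], where a Bernoulli lower tail
      bound has exponent of order [alpha rho^2 m]; then one takes a net of
      squared precision [alpha rho^2 / 64].
    No integral occurs: [eta_i] is only observed through maps with finitely many
    values, so each exponential moment is a finite sum. *)

(** * Elementary inequalities *)

(** From [1 - y <= expR (- y)] one gets [expR y <= 1 / (1 - y)], and [(1 - y) (1 + y + 2 y^2) = 1 +
    y^2 (1 - 2 y) >= 1]. *)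
Lemma expR_le_quadratic (R : realType) (y : R) :
  y <= 1 / 2 -> expR y <= 1 + y + 2 * y ^+ 2.
Proof.
move=> y2.
have h1 : 1 - y <= (expR y)^-1 by rewrite -expRN; have := expR_ge1Dx (- y).
have h2 : expR y * (1 - y) <= 1.
  by rewrite -ler_pdivlMl ?expR_gt0// mulr1.
have e0 := expR_gt0 y.
rewrite -(ler_pM2r (_ : 0 < 1 - y)); last lra.
apply: (le_trans h2); have := sqr_ge0 y; nra.
Qed.

(** Sub-Gaussian bound on [2 ch x]. For [|x| <= 1 / 2] the linear terms of two quadratic bounds
    cancel; repeated doubling reaches every [x]. *)
Lemma expR_sym_le (R : realType) (x : R) :
  expR x + expR (- x) <= 2 * expR (2 * x ^+ 2).
Proof.
have small (y : R) : `|y| <= 1 / 2 -> expR y + expR (- y) <= 2 * expR (2 * y ^+ 2).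
  rewrite ler_norml => /andP[y1 y2].
  have h1 := expR_le_quadratic y2.
  have h2 : expR (- y) <= 1 + - y + 2 * (- y) ^+ 2 by apply: expR_le_quadratic; lra.
  have h3 := expR_ge1Dx (2 * y ^+ 2).
  move: h2; rewrite sqrrN; lra.
have [k] : exists k : nat, `|x| <= 2 ^+ k / 2.
  have [k kx] : exists k : nat, `|x| < k%:R.
    by exists (Num.truncn `|x|).+1; rewrite truncnS_gt.
  exists k.+1; rewrite exprS [2 * _]mulrC mulfK //.
  apply: (le_trans (ltW kx)); rewrite -natrX ler_nat; exact/ltnW/ltn_expl.
(* [ch 2y <= ch^4 y], so the bound propagates from y to 2y. *)
elim: k x => [|k IH] x hx; first by apply: small; rewrite expr0 in hx.
have : `|x / 2| <= 2 ^+ k / 2.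
  by rewrite normrM normfV (ger0_norm (_ : 0 <= 2 :> R))//; move: hx; rewrite exprS; lra.
move/IH; rewrite -mulNr => h.
have e1 : expR x = expR (x / 2) ^+ 2 by rewrite -expRM_natl; congr expR; lra.
have e2 : expR (- x) = expR (- x / 2) ^+ 2 by rewrite -expRM_natl; congr expR; lra.
have e3 : expR (2 * x ^+ 2) = expR (2 * (x / 2) ^+ 2) ^+ 4.
  by rewrite -expRM_natl; congr expR; rewrite expr_div_n; lra.
have e4 : expR (x / 2) * expR (- x / 2) = 1 by rewrite mulNr expRN mulfV// gt_eqF// expR_gt0.
rewrite e1 e2 e3.
move: h e4 (expR_gt0 (x / 2)) (expR_gt0 (- x / 2)) (expR_gt0 (2 * (x/2)^+2)).
move: (expR (x / 2)) (expR (- x / 2)) (expR (2 * (x / 2) ^+ 2)) => a b c h ab a0 b0 c0.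
(* [s] is [ch^2 (x / 2)]. Since [a b = 1], the left side is [4 s - 2], which is at most [2 s^2]
   because [(s - 1)^2 >= 0]. *)
set s := (a + b) ^+ 2 / 4.
have hs : s <= c ^+ 2.
  have : (a + b) ^+ 2 <= (2 * c) ^+ 2 by rewrite ler_pXn2r// nnegrE; lra.
  by rewrite /s exprMn; lra.
have s0 : 0 <= s by rewrite /s divr_ge0// sqr_ge0.
have hs2 : s ^+ 2 <= c ^+ 4 by rewrite (exprM c 2 2) ler_pXn2r// nnegrE ?sqr_ge0//.
have es : a ^+ 2 + b ^+ 2 = 4 * s - 2.
  rewrite /s sqrrD; lra.
have := sqr_ge0 (s - 1); rewrite es sqrrB; lra.
Qed.

(** Here [expR (- x) <= 1 / (1 + x)], and [(1 - x / 2) (1 + x) >= 1] on the unit interval. *)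
Lemma expRN_le (R : realType) (x : R) : 0 <= x <= 1 -> expR (- x) <= 1 - x / 2.
Proof.
move=> /andP[x0 x1]; rewrite expRN.
have h := expR_ge1Dx x.
rewrite -[leLHS]mul1r ler_pdivrMr ?expR_gt0//.
have : (1 - x / 2) * (1 + x) <= (1 - x / 2) * expR x by apply: ler_wpM2l => //; lra.
nra.
Qed.

Lemma ln_le_id (R : realType) (x : R) : 0 < x -> ln x <= x - 1.
Proof.
move=> x0; rewrite -ler_expR lnK ?posrE//.
by have := expR_ge1Dx (x - 1); rewrite addrC subrK.
Qed.

(** Level [2] is the derivative of the Huber penalty; at level [1] the square is
    [min (|x|, 1)^2]. *)
Definition clamp (R : realType) (k x : R) : R := Num.max (- k) (Num.min x k).

Lemma clampP (R : realType) (k x : R) : 0 <= k ->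
  [\/ x <= - k /\ clamp k x = - k, - k <= x <= k /\ clamp k x = x
   | k <= x /\ clamp k x = k].
Proof.
move=> k0; rewrite /clamp.
case: (leP x (- k)) => xk; first by constructor 1; rewrite min_l ?max_l//; lra.
case: (leP x k) => xk2; first by constructor 2; rewrite ?max_r//; lra.
by constructor 3; rewrite max_r//; lra.
Qed.

Lemma clamp_itv (R : realType) (k x : R) : 0 <= k -> - k <= clamp k x <= k.
Proof. by move=> k0; case: (clampP x k0) => -[h ->]; lra. Qed.

Lemma clamp_id (R : realType) (k x : R) : - k <= x <= k -> clamp k x = x.
Proof. by move=> /andP[a b]; rewrite /clamp min_l// max_r. Qed.

Lemma clampN (R : realType) (k x : R) : 0 <= k -> clamp k (- x) = - clamp k x.
Proof.
move=> k0; case: (clampP x k0) => -[h ->];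
  case: (clampP (- x) k0) => -[h' ->]; lra.
Qed.

Lemma clamp_lip (R : realType) (k x y : R) : 0 <= k ->
  (clamp k x - clamp k y) ^+ 2 <= (x - y) ^+ 2.
Proof.
move=> k0; suff : (0 <= clamp k x - clamp k y <= x - y) ||
                 (x - y <= clamp k x - clamp k y <= 0).
  by case/orP => /andP[]; set a := clamp k x - _; set b := x - y; nra.
apply/orP; case: (lerP y x) => xy; [left|right];
  case: (clampP x k0) => -[h ->]; case: (clampP y k0) => -[h' ->]; lra.
Qed.

Lemma clamp_mul_ge (R : realType) (k x : R) : 0 <= k ->
  clamp k x ^+ 2 <= clamp k x * x.
Proof. by move=> k0; case: (clampP x k0) => -[h ->]; nra. Qed.

Lemma huberN (R : realType) (t : R) : huber (- t) = huber t.
Proof. by rewrite /huber normrN sqrrN. Qed.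

(** Fenchel-Young inequality: [huber] is the convex conjugate of [p^2 / 2] on [[-2, 2]]. By
    [huber_clamp], equality holds at [p = clamp 2 t]. *)
Lemma huber_ge (R : realType) (p t : R) : - 2 <= p <= 2 ->
  p * t - p ^+ 2 / 2 <= huber t.
Proof.
move=> /andP[p1 p2]; rewrite /huber; case: ifPn => [_|].
  have := sqr_ge0 (p - t); rewrite sqrrB; lra.
rewrite -ltNge => t2.
have : p * t <= `|p| * `|t| by rewrite -normrM ler_norm.
have : `|p| <= 2 by rewrite ler_norml p1.
rewrite -(real_normK (num_real p)); have := normr_ge0 p.
nra.
Qed.

Lemma huber_clamp (R : realType) (t : R) :
  huber t = clamp 2 t * t - clamp 2 t ^+ 2 / 2.
Proof.
rewrite /huber; case: ifPn => [|].
  by rewrite ler_norml => h; rewrite clamp_id//; lra.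
rewrite -ltNge; case: (clampP t (ler0n R 2)) => -[h ->]; case: (ger0P t) => ht; lra.
Qed.

Lemma huber_sub_ge (R : realType) (e U : R) :
  huber e - clamp 2 e * U <= huber (e - U).
Proof.
have := huber_ge (e - U) (clamp_itv e (ler0n R 2)).
rewrite (huber_clamp e); lra.
Qed.

(** This is [huber_ge] at slope [e - c], admissible since [|e| + |c| <= 2]. The parameter [c]
    expresses the strong convexity gain without a case split on [U]. *)
Lemma huber_sub_ge_inlier (R : realType) (e U c : R) : `|e| <= 1 -> `|c| <= 1 ->
  huber e - clamp 2 e * U + (c * U - c ^+ 2 / 2) <= huber (e - U).
Proof.
rewrite !ler_norml => e1 c1.
have h : - 2 <= e - c <= 2 by lra.
have := huber_ge (e - U) h.
rewrite (huber_clamp e) !clamp_id; lra.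
Qed.

(** * Orthonormal bases and nets *)

Definition sqnorm (R : realType) n (v : 'cV[R]_n) : R := \sum_(i < n) v i 0 ^+ 2.

Lemma sqnorm_ge0 (R : realType) n (v : 'cV[R]_n) : 0 <= sqnorm v.
Proof. by apply: sumr_ge0 => i _; rewrite sqr_ge0. Qed.

Lemma sqnormE (R : realType) n (v : 'cV[R]_n) : (v^T *m v) 0 0 = sqnorm v.
Proof. by rewrite mxE; apply: eq_bigr => i _; rewrite mxE expr2. Qed.

Lemma sqnormZ (R : realType) n (a : R) (v : 'cV[R]_n) :
  sqnorm (a *: v) = a ^+ 2 * sqnorm v.
Proof. by rewrite /sqnorm mulr_sumr; apply: eq_bigr => i _; rewrite mxE exprMn. Qed.

Lemma norm2_sqr (R : realType) n (v : 'cV[R]_n) : norm2 v ^+ 2 = sqnorm v.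
Proof. by rewrite sqr_sqrtr// sqnorm_ge0. Qed.

Lemma sqnorm_eq0 (R : realType) n (v : 'cV[R]_n) : (sqnorm v == 0) = (v == 0).
Proof.
apply/eqP/eqP => [/eqP|->]; last by apply: big1 => i _; rewrite mxE expr0n.
rewrite psumr_eq0 => [/allP h|i _]; last exact: sqr_ge0.
apply/colP => i; apply/eqP; rewrite mxE.
by have := h i (mem_index_enum _); rewrite sqrf_eq0.
Qed.

Lemma sqnorm_isometry (R : realType) n k (Q : 'M[R]_(n, k)) (c : 'cV[R]_k) :
  Q^T *m Q = 1%:M -> sqnorm (Q *m c) = sqnorm c.
Proof. by move=> hQ; rewrite -!sqnormE trmx_mul -mulmxA (mulmxA Q^T) hQ mul1mx. Qed.

(** Gram-Schmidt, one column at a time: the normalized residual of the new column is prepended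
    unless it vanishes. [A] and [B] witness that [X] and [Q] have the same column span. *)
Lemma exists_orthonormal_colspan (R : realType) n d (X : 'M[R]_(n, d)) :
  exists k (Q : 'M[R]_(n, k)), [/\ (k <= d)%N, Q^T *m Q = 1%:M,
    (exists A, X = Q *m A) & exists B, Q = X *m B].
Proof.
elim: d X => [|d IH]; last rewrite -[d.+1]/(1 + d)%N => X.
  move=> X; exists 0, 0; split=> //; first by apply/matrixP => -[].
    by exists 0; apply/matrixP => i [].
  by exists 0; apply/matrixP => i [].
have [k [Q [kd QQ [A XA] [B QB]]]] := IH (rsubmx X).
pose x := lsubmx X; pose res := x - Q *m (Q^T *m x).
have EX : X = row_mx x (Q *m A) by rewrite -XA hsubmxK.
have QX : Q = X *m col_mx 0 B.
  by rewrite EX mul_row_col mulmx0 add0r -XA.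
have [/eqP res0|resN0] := boolP (res == 0).
  exists k, Q; split; [exact: leqW|by []| |by exists (col_mx 0 B)].
  exists (row_mx (Q^T *m x) A); rewrite mul_mx_row EX; congr row_mx.
  by apply/eqP; rewrite -subr_eq0; apply/eqP.
have s0 : 0 < sqnorm res by rewrite lt_def sqnorm_eq0 resN0 sqnorm_ge0.
pose r := Num.sqrt (sqnorm res); have r0 : 0 < r by rewrite sqrtr_gt0.
pose e := r^-1 *: res.
have Qres : Q^T *m res = 0.
  by rewrite mulmxBr !mulmxA QQ mul1mx subrr.
have Qe : Q^T *m e = 0 by rewrite -scalemxAr Qres scaler0.
have ee : e^T *m e = 1%:M.
  apply/matrixP => i j; rewrite !ord1 sqnormE sqnormZ mxE eqxx exprVn sqr_sqrtr ?sqnorm_ge0//.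
  by rewrite mulVf// gt_eqF.
exists (1 + k)%N, (row_mx e Q); split; first by [].
- rewrite tr_row_mx mul_col_row QQ Qe ee (_ : e^T *m Q = 0) -?scalar_mx_block//.
  by apply: trmx_inj; rewrite trmx_mul trmxK Qe trmx0.
- exists (block_mx r%:M 0 (Q^T *m x) A).
  rewrite mul_row_block mulmx0 add0r EX; congr row_mx.
  by rewrite mul_mx_scalar scalerA mulfV ?gt_eqF// scale1r subrK.
- exists (row_mx (col_mx (r^-1)%:M (- (r^-1 *: (B *m (Q^T *m x))))) (col_mx 0 B)).
  rewrite mul_mx_row -QX; congr row_mx.
  have QAB : Q *m A *m B = Q by rewrite -XA -QB.
  by rewrite EX mul_row_col mul_mx_scalar mulmxN -scalemxAr (mulmxA (Q *m A)) QAB -scalerBr.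
Qed.

(** The sum is at most [1 / (1 - expR (- q))], whose denominator is at least [q / 2]. It is the
    contribution of one coordinate and one sign to the count of net points. *)
Lemma geometric_sum_le (R : realType) (q : R) K : 0 < q <= 1 ->
  \sum_(i < K) expR (- q * i%:R) <= 2 / q.
Proof.
move=> /andP[q0 q1].
have h : expR (- q) <= 1 - q / 2 by apply: expRN_le; rewrite ltW.
have e0 := expR_gt0 (- q).
under eq_bigr do rewrite mulrC expRM_natl.
have := subrX1 (expR (- q)) K; set S := \sum_(_ < _) _ => ES.
have S0 : 0 <= S by apply: sumr_ge0 => i _; rewrite exprn_ge0// ltW.
have : 0 <= expR (- q) ^+ K by rewrite exprn_ge0// ltW.
by rewrite ler_pdivlMr//; nra.
Qed.

(* The net consists of the points of the grid of step [sqrt (q / k)], onto which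
   vectors are rounded towards zero.  A net point has integer coordinates [z_j]
   with [sum_j |z_j| <= k / q], so the net has at most
   [sum_z expR (k - q * sum_j |z_j|)] points, a product of geometric sums. *)
Lemma exists_ball_net (R : realType) k (q : R) : 0 < q <= 1 ->
  exists N : seq 'cV[R]_k,
    [/\ (size N)%:R <= expR (k%:R * (1 + ln (4 / q))),
        forall c, c \in N -> sqnorm c <= 1 &
        forall c, sqnorm c <= 1 -> exists2 c', c' \in N & sqnorm (c - c') <= q].
Proof.
move=> /andP[q0 q1].
pose M : R := k%:R / q; have M0 : 0 <= M by rewrite divr_ge0// ltW.
pose K := Num.truncn M.
pose h : R := Num.sqrt (q / k%:R).
have h2 : h ^+ 2 = q / k%:R by rewrite sqr_sqrtr// divr_ge0// ltW.
have h0 : 0 <= h by exact: sqrtr_ge0.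
(* For [k = 0] the step [h] is [0]; an index [j] rules this case out. *)
have kpos (j : 'I_k) : 0 < k%:R :> R by rewrite ltr0n; case: j; case: (k).
have hpos (j : 'I_k) : 0 < h by rewrite sqrtr_gt0 divr_gt0// kpos.
pose T := {ffun 'I_k -> bool * 'I_K.+1}.
pose good : pred T := fun z => \sum_j ((z j).2)%:R ^+ 2 <= M.
pose pt (z : T) : 'cV[R]_k := \col_j ((-1) ^+ (z j).1 * (h * ((z j).2)%:R)).
exists [seq pt z | z <- enum good]; split.
- rewrite size_map -cardE -sum1_card natr_sum.
  (* A good [z] has weight at least [1]: natural numbers satisfy [z_j <= z_j^2], so
     [sum z_j <= M = k / q]. *)
  apply: (@le_trans _ _ (\sum_(z : T) expR (k%:R) * \prod_j expR (- q * ((z j).2)%:R))).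
    rewrite [leRHS](bigID good)/= -[leLHS]addr0 lerD//; last first.
      apply: sumr_ge0 => z _; rewrite mulr_ge0 ?expR_ge0// prodr_ge0//.
    apply: ler_sum => z gz; rewrite -expR_sum -expRD -[leLHS]expR0 ler_expR -mulr_sumr.
    have : \sum_j ((z j).2)%:R <= M.
      apply: le_trans gz; apply: ler_sum => j _.
      by rewrite -natrX ler_nat; case: (nat_of_ord _) => // m; rewrite leq_pmulr.
    by rewrite ler_pdivlMr// mulNr subr_ge0 mulrC.
  (* The sum factors over the coordinates; two signs and the geometric sum give
     [2 * (2 / q) = 4 / q] for each. *)
  rewrite -mulr_sumr -(bigA_distr_bigA (fun _ (p : bool * 'I_K.+1) => expR (- q * p.2%:R))) /=.
  rewrite prodr_const card_ord.
  rewrite -(pair_bigA _ (fun (_ : bool) (i : 'I_K.+1) => expR (- q * i%:R)))/= big_bool /=.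
  rewrite mulrDr mulr1 expRD ler_pM2l ?expR_gt0//.
  rewrite expRM_natl lnK ?posrE ?divr_gt0//.
  have := @geometric_sum_le R q K.+1; rewrite q0 q1 => /(_ isT).
  set S := \sum_(_ < _) _ => hS.
  have S0 : 0 <= S by apply: sumr_ge0 => i _; exact: expR_ge0.
  by apply: lerXn2r; rewrite ?nnegrE; clear -q0 hS S0; lra.
- move=> c /mapP[z]; rewrite mem_enum => gz ->.
  rewrite /sqnorm; under eq_bigr do rewrite mxE exprMn sqrr_sign mul1r exprMn h2.
  rewrite -mulr_sumr.
  case: (posnP k) => [k0|k0]; first by rewrite {1}k0 invr0 mulr0 mul0r ler01.
  have k0' : 0 < k%:R :> R by rewrite ltr0n.
  by rewrite -ler_pdivlMl ?divr_gt0// mulr1 invf_div.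
move=> c c1.
pose m j := Num.truncn (`|c j 0| / h).
have mle j : h * (m j)%:R <= `|c j 0|.
  by rewrite mulrC -ler_pdivlMr ?hpos// truncn_le// divr_ge0.
have mlt j : `|c j 0| < h * (m j)%:R + h.
  have := truncnS_gt (`|c j 0| / h).
  by rewrite -natr1 ltr_pdivrMr ?hpos// mulrDl mul1r [_ * h]mulrC.
have msum : \sum_j (m j)%:R ^+ 2 <= M.
  case: (posnP k) => [k0|k0]; first by rewrite big1// => -[j jk]; exfalso; rewrite k0 in jk.
  have k0' : 0 < k%:R :> R by rewrite ltr0n.
  rewrite -(ler_pM2l (_ : 0 < h ^+ 2)) ?h2 ?divr_gt0//.
  rewrite /M -[X in _ <= X * _]invf_div mulVf ?gt_eqF ?divr_gt0// mulr_sumr.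
  apply: le_trans c1; apply: ler_sum => j _.
  rewrite -h2 -exprMn -[leRHS]real_normK ?num_real//.
  by rewrite ler_pXn2r// nnegrE mulr_ge0.
have mK j : (m j < K.+1)%N.
  rewrite ltnS truncn_ge_nat//; apply: le_trans msum.
  rewrite (bigD1 j)//= -[leLHS]addr0 lerD ?sumr_ge0//.
  by rewrite -natrX ler_nat; case: (m j) => // p; rewrite leq_pmulr.
pose z : T := [ffun j => (c j 0 < 0, inord (m j))].
exists (pt z).
  apply/map_f; rewrite mem_enum /in_mem /= /good.
  by under eq_bigr do rewrite ffunE /= inordK//.
(* Rounding moves each coordinate by at most [h], and [k h^2] is [q], or [0] if [k = 0]. *)
apply: (@le_trans _ _ (\sum_(j < k) h ^+ 2)); last first.
  rewrite sumr_const card_ord h2 -[_ *+ k]mulr_natr.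
  case: (posnP k) => [->|k0]; first by rewrite mulr0 ltW.
  by rewrite divfK// pnatr_eq0 -lt0n.
apply: ler_sum => j _; rewrite !mxE ffunE /= inordK//.
have := mle j; have := mlt j; have := hpos j.
clear; case: (ltrP (c j 0) 0) => cj;
  [rewrite ltr0_norm// expr1|rewrite ger0_norm// expr0]; nra.
Qed.

(** * Exponential tail bounds over finite observations *)

Definition prob (R : realType) dT (T : measurableType dT) (P : probability T R)
  (A : set T) : R := fine (P A).

Lemma probE (R : realType) (dT : measure_display) (T : measurableType dT)
  (P : probability T R) (A : set T) : measurable A -> P A = (prob P A)%:E.
Proof. by move=> mA; rewrite fineK// fin_num_measure. Qed.

Lemma prob_ge0 (R : realType) (dT : measure_display) (T : measurableType dT)
  (P : probability T R) (A : set T) : 0 <= prob P A.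
Proof. by rewrite fine_ge0. Qed.

Lemma prob_setU (R : realType) (dT : measure_display) (T : measurableType dT)
    (P : probability T R) (A B : set T) : measurable A -> measurable B ->
  prob P (A `|` B) <= prob P A + prob P B.
Proof.
move=> mA mB; rewrite -lee_fin EFinD -!probE//; last exact: measurableU.
exact: measureU2.
Qed.

Lemma prob_bigsetU (R : realType) (dT : measure_display) (T : measurableType dT)
    (P : probability T R) (I : Type) (r : seq I) (Q : pred I) (F : I -> set T) :
  (forall i, measurable (F i)) ->
  prob P (\big[setU/set0]_(i <- r | Q i) F i) <= \sum_(i <- r | Q i) prob P (F i).
Proof.
move=> mF; elim: r => [|i r IH]; first by rewrite !big_nil /prob measure0.
rewrite !big_cons; case: ifP => // _.
have mU : measurable (\big[setU/set0]_(i <- r | Q i) F i) by exact: bigsetU_measurable.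
by apply: le_trans (prob_setU P (mF i) mU) _; rewrite lerD2l.
Qed.

Lemma prob_bigsetU_disjoint (R : realType) (dT : measure_display)
    (T : measurableType dT) (P : probability T R) (I : eqType) (r : seq I)
    (F : I -> set T) :
  uniq r -> (forall i, measurable (F i)) ->
  (forall i j, i != j -> F i `&` F j = set0) ->
  prob P (\big[setU/set0]_(i <- r) F i) = \sum_(i <- r) prob P (F i).
Proof.
move=> + mF dF; elim: r => [|i r IH]; first by rewrite !big_nil /prob measure0.
move=> /= /andP[ir ur]; rewrite !big_cons -(IH ur).
have mU : measurable (\big[setU/set0]_(j <- r) F j) by exact: bigsetU_measurable.
apply: EFin_inj; rewrite EFinD -!probE//; last exact: measurableU.
apply: measureU => //; rewrite big_distrr/= big_seq big1// => j jr; apply: dF.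
by apply: contraNneq ir => ->.
Qed.

Lemma measurable_cylinder (R : realType) (dT : measure_display)
    (T : measurableType dT) (P : probability T R) n (eta : 'I_n -> {RV P >-> R})
    (K : finType) (kap : R -> K) (Q : pred {ffun 'I_n -> K}) :
  (forall k, measurable (kap @^-1` [set k])) ->
  measurable [set w | Q [ffun i => kap (eta i w)]].
Proof.
move=> mk.
rewrite (_ : [set w | _] = \bigcup_(f in [set f | Q f])
  \bigcap_(i in [set: 'I_n]) eta i @^-1` (kap @^-1` [set f i])).
  apply: fin_bigcup_measurable; first exact: finite_finset.
  move=> f _; apply: fin_bigcap_measurable; first exact: finite_finset.
  by move=> i _; rewrite -[X in measurable X]setTI; exact: measurable_funPT.
apply/seteqP; split => [w /= Qw|w [f /= Qf fw]].
  by exists [ffun i => kap (eta i w)] => // i _ /=; rewrite ffunE.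
by rewrite (_ : [ffun _ => _] = f)//; apply/ffunP => i; rewrite ffunE (fw i).
Qed.

Definition fiber_prob (R : realType) dT (T : measurableType dT)
    (P : probability T R) n (eta : 'I_n -> {RV P >-> R}) (K : finType)
    (kap : R -> K) (i : 'I_n) (k : K) : R :=
  prob P (eta i @^-1` (kap @^-1` [set k])).

Lemma sum_fiber_prob (R : realType) (dT : measure_display)
    (T : measurableType dT) (P : probability T R) n (eta : 'I_n -> {RV P >-> R})
    (K : finType) (kap : R -> K) (i : 'I_n) :
  (forall k, measurable (kap @^-1` [set k])) ->
  \sum_k fiber_prob eta kap i k = 1.
Proof.
move=> mk; rewrite -prob_bigsetU_disjoint ?index_enum_uniq//; last 2 first.
- by move=> k; rewrite -[X in measurable X]setTI; exact: measurable_funPT.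
- move=> j k jk; apply/seteqP; split => // w /= [-> /eqP].
  by rewrite (negPf jk).
rewrite [X in prob P X](_ : _ = setT) /prob ?probability_setT//.
apply/seteqP; split => // w _; rewrite -bigcup_seq.
by exists (kap (eta i w)) => //=; rewrite mem_index_enum.
Qed.

(** Union bound over the finitely many value patterns [f] satisfying [Q]; independence turns the
    probability of each pattern into a product. *)
Lemma prob_cylinder_le (R : realType) (dT : measure_display)
    (T : measurableType dT) (P : probability T R) n (eta : 'I_n -> {RV P >-> R})
    (K : finType) (kap : R -> K) (Q : pred {ffun 'I_n -> K}) :
  mutually_independent P (fun i => (eta i : T -> R)) ->
  (forall k, measurable (kap @^-1` [set k])) ->
  prob P [set w | Q [ffun i => kap (eta i w)]] <=
  \sum_(f | Q f) \prod_i fiber_prob eta kap i (f i).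
Proof.
move=> ind mk.
(* The index set is written so as to match [mutually_independent] at the full set of indices. *)
pose F (f : {ffun 'I_n -> K}) :=
  \bigcap_(i in [set j | j \in [set: 'I_n]%SET]) eta i @^-1` (kap @^-1` [set f i]).
have mF f : measurable (F f).
  apply: fin_bigcap_measurable; first exact: finite_finset.
  by move=> i _; rewrite -[X in measurable X]setTI; exact: measurable_funPT.
have PF f : prob P (F f) = \prod_i fiber_prob eta kap i (f i).
  apply: EFin_inj; rewrite -probE// ind//.
  rewrite -prodEFin; apply: eq_big => [i|i _]; first by rewrite inE.
  by rewrite probE// -[X in measurable X]setTI; exact: measurable_funPT.
under eq_bigr do rewrite -PF.
rewrite (_ : [set w | _] = \big[setU/set0]_(f | Q f) F f).
  exact: prob_bigsetU.
rewrite -bigcup_seq_cond.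
apply/seteqP; split => [w /= Qw|w [f /= /andP[_ Qf] fw]].
  exists [ffun i => kap (eta i w)] => [|i _] /=; last by rewrite ffunE.
  by rewrite mem_index_enum.
by rewrite (_ : [ffun _ => _] = f)//; apply/ffunP => i; rewrite ffunE (fw i) //= inE.
Qed.

(** Markov's inequality in finite form: the indicator of the event is at most [expR (sum - t)], and
    the resulting sum of products is a product of sums. *)
Lemma chernoff_bound (R : realType) (dT : measure_display)
    (T : measurableType dT) (P : probability T R) n (eta : 'I_n -> {RV P >-> R})
    (K : finType) (kap : R -> K) (g : 'I_n -> K -> R) (t : R) :
  mutually_independent P (fun i => (eta i : T -> R)) ->
  (forall k, measurable (kap @^-1` [set k])) ->
  prob P [set w | t <= \sum_i g i (kap (eta i w))] <=
  expR (- t) * \prod_i \sum_k fiber_prob eta kap i k * expR (g i k).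
Proof.
move=> ind mk.
pose Q := fun f : {ffun 'I_n -> K} => t <= \sum_i g i (f i).
rewrite (_ : [set w | _] = [set w | Q [ffun i => kap (eta i w)]]); last first.
  by apply: eq_set => w; rewrite /Q; under [in RHS]eq_bigr do rewrite ffunE.
apply: le_trans (prob_cylinder_le Q ind mk) _.
rewrite bigA_distr_bigA mulr_sumr big_mkcond/=; apply: ler_sum => f _.
have p0 : 0 <= \prod_i fiber_prob eta kap i (f i).
  by apply: prodr_ge0 => i _; exact: prob_ge0.
rewrite big_split/= -expR_sum mulrCA -expRD; case: ifP => Qf.
  rewrite -[leLHS]mulr1 ler_wpM2l// -expR0 ler_expR addrC subr_ge0; exact: Qf.
by rewrite mulr_ge0// expR_ge0.
Qed.

(** By symmetry [k] and [sg k] are equally likely, so each exponential moment is an average of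
    hyperbolic cosines, bounded by [expR_sym_le]. *)
Lemma hoeffding_symmetric (R : realType) (dT : measure_display)
    (T : measurableType dT) (P : probability T R) n (eta : 'I_n -> {RV P >-> R})
    (K : finType) (kap : R -> K) (sg : K -> K) (a : K -> R) (v : 'cV[R]_n) (t : R) :
  mutually_independent P (fun i => (eta i : T -> R)) ->
  (forall i, symmetric_rv P (eta i)) ->
  (forall k, measurable (kap @^-1` [set k])) ->
  involutive sg -> (forall x, kap (- x) = sg (kap x)) ->
  (forall k, a (sg k) = - a k) -> (forall k, a k ^+ 2 <= 4) ->
  sqnorm v <= 1 -> 0 < t ->
  prob P [set w | t <= \sum_i v i 0 * a (kap (eta i w))] <= expR (- (t ^+ 2 / 32)).
Proof.
move=> ind sym mk sgK kapN aN a4 v1 t0.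
(* This [l] minimizes [8 l^2 - l t], with value [- t^2 / 32]. *)
pose l := t / 16; have l0 : 0 < l by rewrite divr_gt0.
rewrite (_ : [set w | _] =
    [set w | l * t <= \sum_i (l * v i 0) * a (kap (eta i w))]); last first.
  apply: eq_set => w; under [in RHS]eq_bigr do rewrite -mulrA.
  by rewrite -mulr_sumr ler_pM2l.
apply: le_trans (chernoff_bound (fun i k => l * v i 0 * a k) (l * t) ind mk) _.
have psym i k : fiber_prob eta kap i (sg k) = fiber_prob eta kap i k.
  rewrite /fiber_prob /prob [in RHS]sym//; congr (fine (P _)).
  apply/seteqP; split => w /=; rewrite kapN.
    by move=> ->; rewrite sgK.
  by move=> <-; rewrite sgK.
have mgf i : \sum_k fiber_prob eta kap i k * expR (l * v i 0 * a k) <=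
    expR (8 * (l * v i 0) ^+ 2).
  set s := l * v i 0.
  have E2 : \sum_k fiber_prob eta kap i k * expR (s * a k) =
            \sum_k fiber_prob eta kap i k * expR (- (s * a k)).
    rewrite (reindex_inj (inv_inj sgK))/=; apply: eq_bigr => k _.
    by rewrite psym aN mulrN.
  have : \sum_k fiber_prob eta kap i k * expR (s * a k) +
         \sum_k fiber_prob eta kap i k * expR (- (s * a k)) <=
         \sum_k fiber_prob eta kap i k * (2 * expR (8 * s ^+ 2)).
    rewrite -big_split/=; apply: ler_sum => k _.
    rewrite -mulrDr ler_wpM2l ?prob_ge0//; apply: le_trans (expR_sym_le _) _.
    rewrite ler_pM2l// ler_expR exprMn.
    have := sqr_ge0 s; have := a4 k; nra.
  rewrite -mulr_suml sum_fiber_prob// -E2; lra.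
apply: (@le_trans _ _ (expR (- (l * t)) * expR (8 * l ^+ 2))); last first.
  rewrite -expRD ler_expR /l; lra.
rewrite ler_pM2l ?expR_gt0//.
apply: (@le_trans _ _ (\prod_i expR (8 * (l * v i 0) ^+ 2))).
  apply: ler_prod => i _; rewrite mgf andbT; apply: sumr_ge0 => k _.
  by rewrite mulr_ge0 ?expR_ge0 ?prob_ge0.
rewrite -expR_sum ler_expR -mulr_sumr ler_pM2l//.
under eq_bigr do rewrite exprMn.
by rewrite -mulr_sumr -[leRHS]mulr1 ler_wpM2l// sqr_ge0.
Qed.

Definition inlier (R : realType) (x : R) : bool := `|x| <= 1.

Lemma measurable_inlier (R : realType) b : measurable (@inlier R @^-1` [set b]).
Proof.
have mT : measurable (@inlier R @^-1` [set true]).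
  rewrite (_ : _ @^-1` _ = [set` `[- 1, 1 : R]]); first exact: measurable_itv.
  by apply/seteqP; split => x; rewrite /= in_itv/= /inlier ler_norml.
case: b => //; rewrite (_ : _ @^-1` _ = ~` (@inlier R @^-1` [set true])).
  exact: measurableC.
by apply/seteqP; split => x /=; case: (inlier x).
Qed.

(** Chernoff bound with parameter [1 / b]. For [x = a i / b] and inlier probability [p >= alpha],
    the moment [1 - p + p expR (- x)] is at most [1 - alpha x / 2 <= expR (- (alpha x / 2))]. *)
Lemma bernoulli_lower_tail (R : realType) (dT : measure_display)
    (T : measurableType dT) (P : probability T R) n (eta : 'I_n -> {RV P >-> R})
    (alpha : R) (a : 'I_n -> R) (b : R) :
  mutually_independent P (fun i => (eta i : T -> R)) ->
  (forall i, (alpha%:E <= P [set w | (`|eta i w| <= 1)%R])%E) ->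
  0 <= alpha ->
  0 < b -> (forall i, 0 <= a i <= b) ->
  prob P [set w | \sum_i a i * (inlier (eta i w))%:R <= alpha * (\sum_i a i) / 4] <=
  expR (- (alpha * (\sum_i a i) / (4 * b))).
Proof.
move=> ind halpha al0 b0 hab.
set S := \sum_i a i.
rewrite (_ : [set w | _] = [set w | - (alpha * S / (4 * b)) <=
    \sum_i (fun i (e : bool) => - (a i / b) * e%:R) i (inlier (eta i w))]); last first.
  apply: eq_set => w /=.
  under [in RHS]eq_bigr do rewrite mulNr mulrAC.
  rewrite sumrN -mulr_suml lerN2 invfM mulrA ler_pM2r ?invr_gt0//.
apply: le_trans (chernoff_bound (fun i (e : bool) => - (a i / b) * e%:R) _
  ind (@measurable_inlier R)) _.
have pa i : alpha <= fiber_prob eta (@inlier R) i true.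
  have := halpha i.
  rewrite (_ : [set w | _] = eta i @^-1` (@inlier R @^-1` [set true])).
    rewrite probE ?lee_fin//.
    rewrite -[X in measurable X]setTI; apply: measurable_funPT => //.
    exact: measurable_inlier.
  by apply/seteqP; split => w.
rewrite (_ : expR (- (alpha * S / (4 * b))) = expR (- - (alpha * S / (4 * b))) *
    \prod_i expR (- (alpha * (a i / b) / 2))); last first.
  rewrite -expR_sum -expRD; congr expR.
  rewrite sumrN -mulr_suml -mulr_sumr -mulr_suml -/S; field.
  by rewrite gt_eqF.
rewrite ler_pM2l ?expR_gt0//; apply: ler_prod => i _; apply/andP; split.
  by apply: sumr_ge0 => k _; rewrite mulr_ge0 ?expR_ge0 ?prob_ge0.
have := sum_fiber_prob eta i (@measurable_inlier R).
rewrite !big_bool/= mulr0 expR0 mulr1 mulr1 => p1.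
have x01 : 0 <= a i / b <= 1.
  by have /andP[a0 ab] := hab i; rewrite ler_pdivrMr// mul1r ab andbT divr_ge0// ltW.
have := expRN_le x01; have := pa i.
have := expR_ge1Dx (- (alpha * (a i / b) / 2)).
move: (expR (- (a i / b))) (expR (- _)) p1 x01.
set p := fiber_prob _ _ _ true; set p' := fiber_prob _ _ _ false.
set x := a i / b => e1 e2 p1 x01 h1 h2 h3.
nra.
Qed.

(** * Discretized gradient *)

(** Superlevel sets of [truncn] are half-lines, and a fiber is a difference of two of them. Negative
    numbers all lie in fiber [0], which is therefore taken as a complement. *)
Lemma measurable_truncn_fiber (R : realType) (g : R -> R) k :
  measurable_fun setT g -> measurable [set x | Num.truncn (g x) = k].
Proof.
move=> mg.
have mlt j : measurable [set x | (j < Num.truncn (g x))%N].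
  rewrite (_ : [set x | _] = g @^-1` [set` `[j.+1%:R, +oo[]).
    by rewrite -[X in measurable X]setTI; apply: mg => //; exact: measurable_itv.
  by apply/seteqP; split => x; rewrite /= in_itv/= andbT truncn_gt_nat.
case: k => [|k].
  rewrite (_ : [set x | _] = ~` [set x | (0 < Num.truncn (g x))%N]).
    exact: measurableC.
  by apply/seteqP; split => x /=; rewrite lt0n; [move=> ->|move/negP/negPn/eqP].
rewrite (_ : [set x | _] = [set x | (k < Num.truncn (g x))%N] `\`
                           [set x | (k.+1 < Num.truncn (g x))%N]).
  exact: measurableD.
apply/seteqP; split => x /=; first by move=> ->; rewrite ltnn ltnS.
by move=> [h1 /negP]; rewrite -leqNgt => h2; apply/eqP; rewrite eqn_leq h2.
Qed.

Lemma measurable_clamp (R : realType) (k : R) : measurable_fun setT (clamp k).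
Proof.
by apply: measurable_realfun.measurable_maxr => //; apply: measurable_realfun.measurable_minr.
Qed.

(* Positive and negative parts of [clamp 2 x], rounded down to multiples of
   [1 / N]; negating [x] swaps the two components. *)
Definition clamp_index (R : realType) N (x : R) : 'I_(2 * N).+1 * 'I_(2 * N).+1 :=
  (inord (Num.truncn (N%:R * clamp 2 x)), inord (Num.truncn (N%:R * clamp 2 (- x)))).

Definition index_value (R : realType) N (k : 'I_(2 * N).+1 * 'I_(2 * N).+1) : R :=
  ((k.1)%:R - (k.2)%:R) / N%:R.

Definition swap_pair (A : Type) (k : A * A) := (k.2, k.1).

Lemma truncn_clamp_lt (R : realType) N (x : R) :
  (Num.truncn (N%:R * clamp 2 x) < (2 * N).+1)%N.
Proof.
rewrite ltnS truncn_le_nat -(natr1 (2 * N)) natrM.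
have /andP[_ h] := clamp_itv x (ler0n R 2).
have : N%:R * clamp 2 x <= N%:R * 2 by rewrite ler_wpM2l.
lra.
Qed.

Lemma measurable_clamp_index (R : realType) N k :
  measurable (@clamp_index R N @^-1` [set k]).
Proof.
have mg : measurable_fun setT (fun x : R => N%:R * clamp 2 x).
  by apply: measurableT_comp => //; exact: measurable_clamp.
have mg' : measurable_fun setT (fun x : R => N%:R * clamp 2 (- x)).
  apply: measurableT_comp => //; apply: measurableT_comp => //.
  exact: measurable_clamp.
rewrite (_ : _ @^-1` _ = [set x | Num.truncn (N%:R * clamp 2 x) = k.1] `&`
                         [set x | Num.truncn (N%:R * clamp 2 (- x)) = k.2]).
  by apply: measurableI; exact: measurable_truncn_fiber.
case: k => k1 k2; apply/seteqP; split => x /=.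
  by case=> <- <-; rewrite !inordK ?truncn_clamp_lt.
case=> h1 h2; rewrite /clamp_index; congr pair; apply: val_inj;
  by rewrite /= inordK ?truncn_clamp_lt.
Qed.

Lemma index_value_sqr_le (R : realType) N (k : 'I_(2 * N).+1 * 'I_(2 * N).+1) :
  index_value R k ^+ 2 <= 4.
Proof.
case: N k => [|N] [k1 k2]; rewrite /index_value /=.
  by rewrite invr0 mulr0 expr0n.
have N0 : 0 < N.+1%:R :> R by rewrite ltr0n.
have h (j : 'I_(2 * N.+1).+1) : 0 <= (j%:R : R) / N.+1%:R <= 2.
  rewrite divr_ge0//= ler_pdivrMr// -natrM ler_nat -ltnS; exact: ltn_ord.
rewrite mulrBl; have := h k1; have := h k2.
move: (_ / _) (_ / _) => a b; nra.
Qed.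

(** At most one of the two truncations is nonzero, so a single rounding error occurs. *)
Lemma index_value_approx (R : realType) N (x : R) : (0 < N)%N ->
  `|clamp 2 x - index_value R (clamp_index N x)| <= N%:R^-1.
Proof.
move=> N0; have N0' : 0 < N%:R :> R by rewrite ltr0n.
rewrite /index_value /clamp_index/= !inordK ?truncn_clamp_lt// clampN// mulrN.
set y := N%:R * _.
have -> : clamp 2 x = y / N%:R by rewrite /y mulrAC mulfV ?mul1r// gt_eqF.
rewrite -mulrBl normrM normfV (gtr0_norm N0') -[leRHS]mul1r ler_pM2r ?invr_gt0//.
have small (z : R) : z < 1 -> Num.truncn z = 0%N.
  by move=> z1; apply/eqP; rewrite -leqn0 truncn_le_nat.
case: (leP 0 y) => y0.
  rewrite (small (- y)); last by lra.
  by have /andP[h1 h2] := truncn_itv y0; rewrite -natr1 in h2; rewrite ler_norml; lra.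
rewrite (small y); last by lra.
have ny0 : 0 <= - y by lra.
by have /andP[h1 h2] := truncn_itv ny0; rewrite -natr1 in h2; rewrite ler_norml; lra.
Qed.

(** * Duality with a net and the convexity step *)

Definition dot (R : realType) n (u v : 'cV[R]_n) : R := \sum_i u i 0 * v i 0.

Lemma dotE (R : realType) n (u v : 'cV[R]_n) : dot u v = (u^T *m v) 0 0.
Proof. by rewrite mxE; apply: eq_bigr => i _; rewrite mxE. Qed.

Lemma dot_mulmx (R : realType) n k (Q : 'M[R]_(n, k)) u c :
  dot u (Q *m c) = dot (Q^T *m u) c.
Proof. by rewrite !dotE trmx_mul trmxK mulmxA. Qed.

Lemma dot_le (R : realType) n (u v : 'cV[R]_n) (a : R) : 0 < a ->
  dot u v <= a / 2 * sqnorm u + (2 * a)^-1 * sqnorm v.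
Proof.
move=> a0; rewrite !mulr_sumr -big_split/=; apply: ler_sum => i _.
set x := u i 0; set y := v i 0.
have -> : a / 2 * x ^+ 2 + (2 * a)^-1 * y ^+ 2 =
    x * y + (a * x - y) ^+ 2 / (2 * a) by field; rewrite gt_eqF.
by rewrite lerDl divr_ge0 ?sqr_ge0//; lra.
Qed.

Lemma sqnormB_ge (R : realType) n (u v : 'cV[R]_n) :
  sqnorm u / 2 - sqnorm (u - v) <= sqnorm v.
Proof.
rewrite -sumrN mulr_suml -big_split/=; apply: ler_sum => i _; rewrite !mxE.
have := sqr_ge0 (u i 0 / 2 - (u i 0 - v i 0) ); nra.
Qed.

(** Only the net point [c'] near the direction [e] of [g] matters: [dot e c' >= 1 / 2], so the norm
    of [g] is at most [2 s], and Cauchy-Schwarz concludes. *)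
Lemma dot_le_of_net (R : realType) k (N : seq 'cV[R]_k) (g : 'cV[R]_k) (s : R) :
  (forall c, sqnorm c <= 1 -> exists2 c', c' \in N & sqnorm (c - c') <= 1 / 4) ->
  0 <= s -> (forall c, c \in N -> dot g c <= s) ->
  forall c, sqnorm c <= 1 -> dot g c <= 2 * s.
Proof.
move=> net s0 gs c c1.
have [/eqP g0|gN0] := boolP (g == 0).
  by rewrite g0 /dot big1 ?mulr_ge0// => i _; rewrite mxE mul0r.
have sg0 : 0 < sqnorm g by rewrite lt_def sqnorm_eq0 gN0 sqnorm_ge0.
pose r := Num.sqrt (sqnorm g); have r0 : 0 < r by rewrite sqrtr_gt0.
have r2 : r ^+ 2 = sqnorm g by rewrite sqr_sqrtr// sqnorm_ge0.
pose e := r^-1 *: g.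
have ge : g = r *: e by rewrite scalerA mulfV ?scale1r// gt_eqF.
have e1 : sqnorm e = 1 by rewrite sqnormZ -r2 -exprMn mulVf ?expr1n// gt_eqF.
have gd v : dot g v = r * dot e v.
  by rewrite {1}ge /dot mulr_sumr; apply: eq_bigr => i _; rewrite mxE mulrA.
have [|c' c'N ec'] := net e; first by rewrite e1.
have h1 := gs c' c'N.
have ee : dot e e = 1 by rewrite -e1; apply: eq_bigr => i _; rewrite expr2.
have : dot e (e - c') = 1 - dot e c'.
  by rewrite !dotE mulmxBr mxE [X in _ + X]mxE -!dotE ee.
(* The weight [1 / 2] is optimal in [dot_le] for vectors of norms [1] and [1 / 2]. *)
have half0 : 0 < 1 / 2 :> R by lra.
have := dot_le e (e - c') half0; rewrite e1 => h2 h3.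
have h4 : 1 / 2 <= dot e c' by lra.
have h5 : dot e c <= 1 by have := dot_le e c (ltr01 : 0 < 1 :> R); rewrite e1; lra.
rewrite gd in h1; rewrite gd; nra.
Qed.

(** The inlier bound is used with [c = clamp 1 (r * w i)], at the threshold [r] instead of the
    actual length [r']. The gain is then linear in [r'], which cancels; this replaces passing to the
    point at distance [r] on the segment. *)
Lemma huber_step (R : realType) n (e w : 'I_n -> R) (r r' G : R) :
  0 < r <= r' ->
  \sum_i huber (e i - r' * w i) <= \sum_i huber (e i) ->
  \sum_i clamp 2 (e i) * w i <= G ->
  \sum_i (inlier (e i))%:R * clamp 1 (r * w i) ^+ 2 <= 2 * r * G.
Proof.
move=> /andP[r0 rr'] hmin hG.
have pt i : huber (e i) - r' * (clamp 2 (e i) * w i) +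
    r' / (2 * r) * ((inlier (e i))%:R * clamp 1 (r * w i) ^+ 2) <=
    huber (e i - r' * w i).
  case: (boolP (inlier (e i))) => [ei|_]; last first.
    have := huber_sub_ge (e i) (r' * w i); rewrite /= mul0r mulr0 addr0; lra.
  have c1 : `|clamp 1 (r * w i)| <= 1 by rewrite ler_norml clamp_itv.
  have := huber_sub_ge_inlier (r' * w i) ei c1.
  have := clamp_mul_ge (r * w i) (ler01 : 0 <= 1 :> R).
  rewrite mul1r; set c := clamp 1 _ => h.
  have {}h : r' / r * c ^+ 2 <= c * (r' * w i).
    have -> : c * (r' * w i) = r' / r * (c * (r * w i)) by field; rewrite gt_eqF.
    by rewrite ler_wpM2l// divr_ge0//; lra.
  have : c ^+ 2 <= r' / r * c ^+ 2.
    by rewrite -[leLHS]mul1r ler_wpM2r ?sqr_ge0// ler_pdivlMr// mul1r.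
  have -> : r' / (2 * r) * c ^+ 2 = r' / r * c ^+ 2 / 2 by field; rewrite gt_eqF.
  lra.
have : \sum_i (huber (e i) - r' * (clamp 2 (e i) * w i) +
    r' / (2 * r) * ((inlier (e i))%:R * clamp 1 (r * w i) ^+ 2)) <=
    \sum_i huber (e i - r' * w i) by exact: ler_sum.
rewrite !big_split/= sumrN -!mulr_sumr.
move: hG hmin; set A := \sum_i _ * w i; set B := \sum_i _ * _ ^+ 2 => hG hmin hs.
have r'0 : 0 < r' by lra.
have : r' / (2 * r) * B <= r' * G.
  have : r' * A <= r' * G by rewrite ler_pM2l.
  lra.
have -> : r' / (2 * r) * B = r' * (B / (2 * r)) by ring.
rewrite ler_pM2l// ler_pdivrMr; lra.
Qed.

(** * The two high-probability events *)

Lemma prob_net_union_le (R : realType) (dT : measure_display)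
    (T : measurableType dT) (P : probability T R) (I : choiceType) (N : seq I)
    (Q : pred I) (F : I -> set T) (a b : R) :
  (forall c, measurable (F c)) -> (size N)%:R <= a -> 0 <= b ->
  (forall c, c \in N -> Q c -> prob P (F c) <= b) ->
  exists B : set T, [/\ measurable B, prob P B <= a * b &
    forall w, ~ B w -> forall c, c \in N -> Q c -> ~ F c w].
Proof.
move=> mF Na b0 Fb; exists (\big[setU/set0]_(c <- N | Q c) F c); split.
- exact: bigsetU_measurable.
- apply: le_trans (prob_bigsetU _ _ _ mF) _.
  apply: (@le_trans _ _ (\sum_(c <- N) b)).
    rewrite big_mkcond !big_seq; apply: ler_sum => c cN.
    by case: ifP => // Qc; exact: Fb.
  by rewrite big_const_seq count_predT iter_addr_0 -mulr_natl ler_wpM2r.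
- move=> w; rewrite -bigcup_seq_cond => nB c cN Qc Fcw; apply: nB.
  by exists c => //=; rewrite cN Qc.
Qed.

(** The tail bound is applied to the discretized gradient at each point of a net of squared
    precision [1 / 4]. Duality costs the factor [2], discretization the summand [1]. *)
Lemma gradient_event (R : realType) (dT : measure_display)
    (T : measurableType dT) (P : probability T R) n (eta : 'I_n -> {RV P >-> R})
    k (Q : 'M[R]_(n, k)) (t : R) :
  mutually_independent P (fun i => (eta i : T -> R)) ->
  (forall i, symmetric_rv P (eta i)) ->
  Q^T *m Q = 1%:M -> 0 < t ->
  exists B : set T, [/\ measurable B,
    prob P B <= expR (k%:R * (1 + ln 16)) * expR (- (t ^+ 2 / 32)) &
    forall w, ~ B w -> forall c, sqnorm c <= 1 ->
      dot (\col_i clamp 2 (eta i w)) (Q *m c) <= 2 * (t + 1)].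
Proof.
move=> ind sym QQ t0.
have q01 : 0 < (1 / 4 : R) <= 1 by apply/andP; split; lra.
have [N [sN N1 netN]] := exists_ball_net k q01.
have e16 : 4 / (1 / 4) = 16 :> R by lra.
rewrite e16 in sN.
(* With mesh [1 / M], the discretization error of the inner product is at most [n / M <= 1]. *)
pose M := n.+1.
pose kap := @clamp_index R M; pose a := @index_value R M.
pose F (c : 'cV[R]_k) := [set w | t <= \sum_i (Q *m c) i 0 * a (kap (eta i w))].
have mk : forall l, measurable (kap @^-1` [set l]) by exact: measurable_clamp_index.
have mF c : measurable (F c).
  pose f (g : {ffun 'I_n -> 'I_(2 * M).+1 * 'I_(2 * M).+1}) :=
    t <= \sum_i (Q *m c) i 0 * a (g i).
  rewrite (_ : F c = [set w | f [ffun i => kap (eta i w)]]).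
    exact: measurable_cylinder.
  by apply: eq_set => w; rewrite /f; under [in RHS]eq_bigr do rewrite ffunE.
have PF c : c \in N -> predT c -> prob P (F c) <= expR (- (t ^+ 2 / 32)).
  move=> cN _; apply: (@hoeffding_symmetric R dT T P n eta _ kap (@swap_pair _) a) => //.
  - by case.
  - by move=> x; rewrite /kap /clamp_index /swap_pair/= opprK.
  - by move=> l; rewrite /a /index_value /swap_pair/= -mulNr opprB.
  - by move=> l; exact: index_value_sqr_le.
  - by rewrite sqnorm_isometry//; exact: N1.
have [B [mB PB HB]] := prob_net_union_le mF sN (expR_ge0 _) PF.
exists B; split=> // w nBw.
move=> c c1; rewrite dot_mulmx; move: c c1.
apply: (dot_le_of_net netN); first lra.
move=> c cN; rewrite -dot_mulmx.
have /negP := HB w nBw c cN isT; rewrite -ltNge => hlt.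
set v := Q *m c in hlt *.
have v1 : sqnorm v <= 1 by rewrite sqnorm_isometry//; exact: N1.
have vi i : `|v i 0| <= 1.
  rewrite -(expr_le1 (_ : 0 < 2)%N)// real_normK ?num_real//.
  apply: le_trans v1; rewrite /sqnorm (bigD1 i)//= lerDl.
  by apply: sumr_ge0 => j _; exact: sqr_ge0.
have M0 : 0 < M%:R :> R by rewrite ltr0n.
have : dot (\col_i clamp 2 (eta i w)) v <=
    \sum_i (v i 0 * a (kap (eta i w)) + M%:R^-1).
  apply: ler_sum => i _; rewrite mxE -lerBlDl mulrC -mulrBr.
  apply: le_trans (ler_norm _) _; rewrite normrM -[leRHS]mul1r.
  by apply: ler_pM => //; exact: index_value_approx.
rewrite big_split/= sumr_const card_ord => h.
have : M%:R^-1 *+ n <= 1 :> R.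
  by rewrite -[_ *+ n]mulr_natl ler_pdivrMr// mul1r ler_nat.
lra.
Qed.

Lemma inlier_event (R : realType) (dT : measure_display)
    (T : measurableType dT) (P : probability T R) n (eta : 'I_n -> {RV P >-> R})
    k (Q : 'M[R]_(n, k)) (alpha rho m : R) :
  mutually_independent P (fun i => (eta i : T -> R)) ->
  (forall i, (alpha%:E <= P [set w | (`|eta i w| <= 1)%R])%E) ->
  Q^T *m Q = 1%:M -> 0 < alpha <= 1 -> 0 < rho < 1 -> 0 < m ->
  spread (colspan Q) m rho ->
  exists B : set T, [/\ measurable B,
    prob P B <= expR (k%:R * (1 + ln (4 / (alpha * rho ^+ 2 / 64)))) *
                expR (- (alpha * rho ^+ 2 * m / 16)) &
    forall w, ~ B w -> forall c r, sqnorm c = 1 -> 0 < r -> r ^+ 2 <= m ->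
      alpha * rho ^+ 2 * r ^+ 2 / 64 <=
      \sum_i (inlier (eta i w))%:R * clamp 1 (r * (Q *m c) i 0) ^+ 2].
Proof.
move=> ind halpha QQ /andP[al0 al1] /andP[rho0 rho1] m0 spr.
(* The net loses at most [r^2 q], half of the lower bound [alpha rho^2 r^2 / 32] obtained at net
   points. *)
set q := alpha * rho ^+ 2 / 64.
have rho2 : 0 < rho ^+ 2 <= 1 by rewrite exprn_gt0//= expr_le1// ltW.
have ar : 0 < alpha * rho ^+ 2 <= 1.
  have /andP[r1 r2] := rho2; rewrite mulr_gt0//= -[leRHS]mul1r.
  by apply: ler_pM => //; exact: ltW.
have q01 : 0 < q <= 1 by rewrite /q; lra.
have [N [sN N1 netN]] := exists_ball_net k q01.
(* Only coordinates with [v_i^2 <= 1 / m] are kept: for [r^2 <= m] they satisfy [|r v_i| <= 1], so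
   [clamp 1] leaves them unchanged. *)
pose a (v : 'cV[R]_n) i := if v i 0 ^+ 2 <= m^-1 then v i 0 ^+ 2 else 0.
pose F c := [set w | \sum_i a (Q *m c) i * (inlier (eta i w))%:R <=
                     alpha * (\sum_i a (Q *m c) i) / 4].
have mF c : measurable (F c).
  pose f (g : {ffun 'I_n -> bool}) :=
    \sum_i a (Q *m c) i * (g i)%:R <= alpha * (\sum_i a (Q *m c) i) / 4.
  rewrite (_ : F c = [set w | f [ffun i => @inlier R (eta i w)]]).
    exact: (measurable_cylinder eta f (@measurable_inlier R)).
  by apply: eq_set => w; rewrite /f; under [in RHS]eq_bigr do rewrite ffunE.
(* At most [m] coordinates of a vector of norm at most [1] have square above [1 / m], so spreadness
   applies to the others. *)
have asum c : sqnorm c <= 1 -> 1 / 4 <= sqnorm c ->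
    rho ^+ 2 / 4 <= \sum_i a (Q *m c) i.
  move=> c1 c4; set v := Q *m c.
  have vc : sqnorm v = sqnorm c by exact: sqnorm_isometry.
  pose S := [set i : 'I_n | v i 0 ^+ 2 <= m^-1]%SET.
  have cS : n%:R - m <= #|S|%:R.
    have -> : n%:R = #|S|%:R + #|~: S|%:R :> R by rewrite -natrD cardsC card_ord.
    rewrite lerBlDl addrC lerD2r.
    rewrite -[leRHS]mul1r -ler_pdivrMr//; apply: le_trans c1; rewrite -vc.
    rewrite mulr_natl -sumr_const /sqnorm [leRHS](bigID (mem S))/=.
    rewrite -[leLHS]add0r; apply: lerD; first by apply: sumr_ge0 => i _; exact: sqr_ge0.
    rewrite (eq_bigl (fun i => i \notin S)) => [|i]; last by rewrite inE.
    by apply: ler_sum => i; rewrite inE -ltNge => /ltW.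
  have vV : colspan Q v by exists c.
  have := spr v vV S cS; rewrite -(ler_pXn2r (_ : 0 < 2)%N)//; last 2 first.
  - by rewrite nnegrE mulr_ge0 ?sqrtr_ge0// ltW.
  - by rewrite nnegrE sqrtr_ge0.
  rewrite exprMn norm2_sqr vc /norm2_on sqr_sqrtr; last first.
    by apply: sumr_ge0 => i _; exact: sqr_ge0.
  have -> : \sum_(i in S) v i 0 ^+ 2 = \sum_i a v i.
    by rewrite big_mkcond/=; apply: eq_bigr => i _; rewrite inE.
  have /andP[r1 r2] := rho2; nra.
(* Net points of small norm are discarded; one close to a unit vector has squared norm at least
   [1 / 2 - q >= 1 / 4]. *)
pose Qc (c : 'cV[R]_k) := 1 / 4 <= sqnorm c.
have PF c : c \in N -> Qc c -> prob P (F c) <= expR (- (alpha * rho ^+ 2 * m / 16)).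
  move=> cN c4; have mi0 : 0 < m^-1 by rewrite invr_gt0.
  apply: le_trans (bernoulli_lower_tail ind halpha (ltW al0) mi0 _) _.
    move=> i; rewrite /a; case: ifP => [->|_]; last by rewrite lexx ltW.
    by rewrite sqr_ge0.
  have := asum c (N1 c cN) c4; set A := \sum_i _ => hA.
  rewrite ler_expR lerN2 invfM invrK.
  have -> : alpha * A * (4^-1 * m) = alpha * m / 4 * A by ring.
  have -> : alpha * rho ^+ 2 * m / 16 = alpha * m / 4 * (rho ^+ 2 / 4) by field.
  by rewrite ler_wpM2l// divr_ge0// mulr_ge0 ?ltW.
have [B [mB PB HB]] := prob_net_union_le mF sN (expR_ge0 _) PF.
exists B; split=> // w nBw c r c1 r0 rm.
have [|c' c'N ecc] := netN c; first by rewrite c1.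
have c'4 : Qc c'.
  by have := sqnormB_ge c c'; rewrite /Qc c1; move: ecc ar; rewrite /q; lra.
have /negP := HB w nBw c' c'N c'4; rewrite -ltNge => hB.
have hA := asum c' (N1 c' c'N) c'4.
set u := Q *m c; set v := Q *m c' in hB hA *.
have uv : sqnorm (u - v) <= q by rewrite -mulmxBr sqnorm_isometry.
have r20 : 0 < r ^+ 2 by rewrite exprn_gt0.
(* At an inlier this follows from [y^2 / 2 - (x - y)^2 <= x^2] for the clamped values [x] of [r u_i]
   and [y] of [r v_i], as clamping is 1-Lipschitz. *)
have pt i : r ^+ 2 / 2 * (a v i * (inlier (eta i w))%:R) - r ^+ 2 * (u - v) i 0 ^+ 2
     <= (inlier (eta i w))%:R * clamp 1 (r * u i 0) ^+ 2.
  case: (inlier _); rewrite ?mulr0 ?mul0r ?mulr1 ?mul1r; last first.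
    by rewrite sub0r oppr_le0 mulr_ge0 ?sqr_ge0.
  have hv : r ^+ 2 * a v i <= clamp 1 (r * v i 0) ^+ 2.
    rewrite /a; case: ifP => [vm|_]; last by rewrite mulr0 sqr_ge0.
    rewrite clamp_id ?exprMn// -ler_norml -(expr_le1 (_ : 0 < 2)%N)//.
    rewrite real_normK ?num_real// exprMn.
    apply: (@le_trans _ _ (m * m^-1)); last by rewrite mulfV// gt_eqF.
    by apply: ler_pM => //; rewrite ?sqr_ge0 ?ltW.
  have hl := clamp_lip (r * u i 0) (r * v i 0) (ler01 : 0 <= 1 :> R).
  rewrite -mulrBr exprMn in hl.
  have -> : (u - v) i 0 = u i 0 - v i 0 by rewrite !mxE.
  move: hv hl; move: (clamp 1 _) (clamp 1 _) => x y hv hl.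
  have := sqr_ge0 (y / 2 - (x - y)) ; have := sqr_ge0 (2 * x - y); nra.
apply: (@le_trans _ _ (\sum_i (r ^+ 2 / 2 * (a v i * (inlier (eta i w))%:R) -
    r ^+ 2 * (u - v) i 0 ^+ 2))); last by apply: ler_sum => i _; exact: pt.
rewrite big_split/= sumrN -!mulr_sumr -/(sqnorm (u - v)).
move: hB hA uv; rewrite -/v.
set A := \sum_i a v i; set W := \sum_i _ * _; set D := sqnorm (u - v).
move=> hB hA uv.
have h1 : alpha * rho ^+ 2 / 16 <= W.
  apply: le_trans (ltW hB).
  by have : alpha * (rho ^+ 2 / 4) <= alpha * A by [rewrite ler_wpM2l// ltW]; lra.
have h2 : r ^+ 2 * D <= r ^+ 2 * q by rewrite ler_wpM2l// ltW.
have h3 : r ^+ 2 / 2 * (alpha * rho ^+ 2 / 16) <= r ^+ 2 / 2 * W.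
  by rewrite ler_wpM2l// divr_ge0// ltW.
rewrite /q in h2; lra.
Qed.

(** * Choice of constants and the final contradiction *)

Lemma ln_ge_subV (R : realType) (x : R) : 0 < x -> 1 - x^-1 <= ln x.
Proof.
move=> x0; have := @ln_le_id R x^-1; rewrite invr_gt0 => /(_ x0).
by rewrite lnV ?posrE//; lra.
Qed.

Theorem mainTheorem2 (R : realType) :
  exists C C' : R, 0 < C /\ 0 < C' /\
  forall (n d : nat) (X : 'M[R]_(n, d))
    (dT : measure_display) (T : measurableType dT) (P : probability T R)
    (eta : 'I_n -> {RV P >-> R}) (alpha rho delta : R),
    mutually_independent P (fun i => (eta i : T -> R)) ->
    (forall i, symmetric_rv P (eta i)) ->
    (forall i, (alpha%:E <= P [set w | (`|eta i w| <= 1)%R])%E) ->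
    (exists i, P [set w | `|eta i w| <= 1] = alpha%:E) ->
    0 < alpha ->
    0 < rho < 1 -> 0 < delta < 1 ->
    spread (colspan X)
      (C * (d%:R * ln (10 / rho) + ln (2 / delta)) / (rho ^+ 4 * alpha ^+ 2)) rho ->
    exists E : set T, measurable E /\ ((1 - delta)%:E <= P E)%E /\
      forall w, E w ->
        forall (beta_star beta_hat : 'cV[R]_d),
          let y := X *m beta_star + \col_(i < n) eta i w in
          is_minimizer X y beta_hat ->
          n%:R^-1 * norm2 (X *m (beta_star - beta_hat)) ^+ 2 <=
          C' * (d%:R + ln (2 / delta)) / (rho ^+ 4 * alpha ^+ 2 * n%:R).
Proof.
(* The final contradiction needs a second constant above [2 ^+ 27]. The first is large enough for
   [r^2 <= m] and for the inlier tail to beat its net. *)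
exists (2 ^+ 29), (2 ^+ 28); split; [exact: exprn_gt0|split; first exact: exprn_gt0].
move=> n d X dT T P eta alpha rho delta ind sym halpha [i0 Pi0] al0 rho01 delta01.
set L := ln (2 / delta); set D := d%:R + L; set m := (X in spread _ X _) => spr.
have [/andP[rho0 rho1] /andP[de0 de1]] := (rho01, delta01).
(* The index [i0] attaining the minimum makes [alpha] a probability; below it also gives [0 < n]. *)
have al1 : alpha <= 1.
  have mI : measurable [set w | (`|eta i0 w| <= 1)%R].
    rewrite (_ : [set w | _] = eta i0 @^-1` (@inlier R @^-1` [set true])).
      rewrite -[X in measurable X]setTI; apply: measurable_funPT => //.
      exact: measurable_inlier.
    by apply/seteqP; split => w.
  by rewrite -lee_fin -Pi0 probability_le1.
have al01 : 0 < alpha <= 1 by rewrite al0 al1.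
have n0 : 0 < n%:R :> R by rewrite ltr0n (leq_ltn_trans _ (ltn_ord i0)).
have L2 : 1 / 2 <= L.
  have x0 : 0 < 2 / delta by rewrite divr_gt0.
  by have := ln_ge_subV x0; rewrite invf_div -/L; lra.
have lnr : 9 / 10 <= ln (10 / rho).
  have x0 : 0 < 10 / rho by rewrite divr_gt0.
  by have := ln_ge_subV x0; rewrite invf_div; lra.
have d0 : 0 <= d%:R :> R by [].
have D2 : 1 / 2 <= D by rewrite /D; lra.
have D0 : 0 < D by lra.
set x := (alpha * rho ^+ 2)^-1.
have rho2 : 0 < rho ^+ 2 <= 1 by rewrite exprn_gt0//= expr_le1// ltW.
have ar0 : 0 < alpha * rho ^+ 2 by rewrite mulr_gt0// exprn_gt0.
have x1 : 1 <= x.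
  rewrite /x -[leLHS]invr1 lef_pV2 ?posrE// -[leRHS]mul1r.
  by have /andP[? ?] := rho2; apply: ler_pM => //; rewrite ltW.
have denE : (rho ^+ 4 * alpha ^+ 2)^-1 = x ^+ 2.
  by rewrite /x exprVn; congr (_^-1); ring.
have mE : m = 2 ^+ 29 * (d%:R * ln (10 / rho) + L) * x ^+ 2 by rewrite /m denE.
have dln : 9 / 10 * d%:R <= d%:R * ln (10 / rho) by rewrite mulrC ler_wpM2l.
have mD : 2 ^+ 28 * D * x ^+ 2 <= m.
  by rewrite mE ler_wpM2r ?sqr_ge0// /D; lra.
have x20 : 0 < x ^+ 2 by rewrite exprn_gt0//; lra.
have rD0 : 0 < 2 ^+ 28 * D * x ^+ 2 by rewrite mulr_gt0// mulr_gt0.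
have m0 : 0 < m by apply: lt_le_trans mD.
have [k [Q [kd QQ [A XA] [B QB]]]] := exists_orthonormal_colspan X.
have kdR : k%:R <= d%:R :> R by rewrite ler_nat.
have sprQ : spread (colspan Q) m rho.
  by move=> v [c ->]; apply: spr; exists (B *m c); rewrite mulmxA -QB.
(* Then [t^2 / 32 = 16 D], which pays for the net, [k (1 + ln 16) <= 16 d], and leaves at least
   [L]. *)
pose t := Num.sqrt (512 * D).
have t2 : t ^+ 2 = 512 * D by exact: sqr_sqrtr (mulr_ge0 (ler0n R 512) (ltW D0)).
have t1 : 1 <= t.
  rewrite -(ler_pXn2r (_ : 0 < 2)%N)// ?nnegrE ?sqrtr_ge0// t2 expr1n; lra.
have t0 : 0 < t by lra.
have half_delta : expR (- L) = delta / 2.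
  by rewrite expRN lnK ?posrE ?divr_gt0// invf_div.
have [B1 [mB1 PB1 HB1]] := gradient_event ind sym QQ t0.
have [B2 [mB2 PB2 HB2]] := inlier_event ind halpha QQ al01 rho01 m0 sprQ.
have {}PB1 : prob P B1 <= delta / 2.
  apply: le_trans PB1 _; rewrite -expRD -half_delta ler_expR t2.
  have h16 : ln 16 <= 15 :> R by have := @ln_le_id R 16; lra.
  have : k%:R * (1 + ln 16) <= k%:R * 16 :> R by rewrite ler_wpM2l//; lra.
  by rewrite /D; lra.
have {}PB2 : prob P B2 <= delta / 2.
  apply: le_trans PB2 _; rewrite -expRD -half_delta ler_expR.
  have -> : 4 / (alpha * rho ^+ 2 / 64) = 256 * x by rewrite /x; field; rewrite !gt_eqF.
  (* A linear bound on the logarithm suffices: [m] is of order [x^2], so the tail exponent itself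
     grows linearly in [x]. *)
  have hl : ln (256 * x) <= 256 * x - 1 by apply: ln_le_id; lra.
  have h1 : k%:R * (1 + ln (256 * x)) <= d%:R * (256 * x).
    apply: (@le_trans _ _ (k%:R * (256 * x))); first by rewrite ler_wpM2l//; lra.
    by rewrite ler_wpM2r//; lra.
  have -> : alpha * rho ^+ 2 * m / 16 = 2 ^+ 25 * (d%:R * ln (10 / rho) + L) * x.
    by rewrite mE /x; field; rewrite !gt_eqF.
  have h2 : 9 / 10 * d%:R * x <= d%:R * ln (10 / rho) * x by rewrite ler_wpM2r//; lra.
  have h3 : L * 1 <= L * x by rewrite ler_wpM2l//; lra.
  have h4 : 0 <= d%:R * x by rewrite mulr_ge0//; lra.
  lra.
exists (~` (B1 `|` B2)); split; first by apply: measurableC; exact: measurableU.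
split.
  have mU := measurableU _ _ mB1 mB2.
  rewrite probability_setC// probE// -EFinB lee_fin.
  by have := prob_setU P mB1 mB2; lra.
move=> w /not_orP[nB1 nB2] bs bh y hmin.
pose r := Num.sqrt (2 ^+ 28 * D * x ^+ 2).
have r2 : r ^+ 2 = 2 ^+ 28 * D * x ^+ 2 by rewrite sqr_sqrtr// ltW.
have r0 : 0 < r by rewrite sqrtr_gt0.
pose U := X *m (bh - bs).
rewrite norm2_sqr -opprB mulmxN -/U -scaleN1r sqnormZ sqrrN expr1n mul1r.
rewrite invfM mulrA denE mulrC ler_pM2r ?invr_gt0// -r2 leNgt; apply/negP => rU.
have U0 : 0 < sqnorm U by apply: le_lt_trans rU; exact: sqr_ge0.
pose r' := Num.sqrt (sqnorm U).
have r'0 : 0 < r' by rewrite sqrtr_gt0.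
have r'2 : r' ^+ 2 = sqnorm U by rewrite sqr_sqrtr// ltW.
have rr' : r <= r' by rewrite -(ler_pXn2r (_ : 0 < 2)%N) ?nnegrE ?ltW// r'2.
(* These are the coordinates of the unit vector [U / r'] in the orthonormal basis [Q]. *)
pose c := r'^-1 *: (A *m (bh - bs)).
have UQ : U = r' *: (Q *m c).
  by rewrite -scalemxAr scalerA mulfV ?gt_eqF// scale1r mulmxA -XA.
have c1 : sqnorm c = 1.
  apply/(mulfI (_ : r' ^+ 2 != 0)); first by rewrite gt_eqF// exprn_gt0.
  by rewrite mulr1 [RHS]r'2 UQ [RHS]sqnormZ sqnorm_isometry.
have hloss : \sum_i huber (eta i w - r' * (Q *m c) i 0) <= \sum_i huber (eta i w).
  have e1 i : huber ((X *m bh - y) i 0) = huber (eta i w - r' * (Q *m c) i 0).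
    have -> : r' * (Q *m c) i 0 = U i 0 by rewrite UQ [RHS]mxE.
    by rewrite -huberN /y /U mulmxBr !mxE; congr huber; ring.
  have e2 i : huber ((X *m bs - y) i 0) = huber (eta i w).
    by rewrite -huberN /y !mxE; congr huber; ring.
  have := hmin bs; rewrite /huber_loss ler_pM2l ?invr_gt0//.
  by under eq_bigr do rewrite e1; under [leRHS]eq_bigr do rewrite e2.
have hgrad : \sum_i clamp 2 (eta i w) * (Q *m c) i 0 <= 2 * (t + 1).
  have := HB1 w nB1 c; rewrite c1 => /(_ (lexx _)); apply: le_trans.
  by rewrite /dot; under [leRHS]eq_bigr do rewrite mxE.
have rm : r ^+ 2 <= m by rewrite r2.
have rr'0 : 0 < r <= r' by rewrite r0.
have hlow := HB2 w nB2 c r c1 r0 rm.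
have hup := huber_step rr'0 hloss hgrad.
(* The two bounds give [alpha rho^2 r <= 256 (t + 1)], and [1 <= t]. *)
have hr : alpha * rho ^+ 2 * r <= 512 * t.
  have : r * (alpha * rho ^+ 2 * r / 64) <= r * (4 * (t + 1)).
    by have := le_trans hlow hup; lra.
  by rewrite ler_pM2l//; lra.
have : (alpha * rho ^+ 2 * r) ^+ 2 <= (512 * t) ^+ 2.
  by rewrite ler_pXn2r// nnegrE mulr_ge0// ltW.
(* The squares are [2 ^+ 28 * D] on the left and [2 ^+ 27 * D] on the right, contradicting
   [0 < D]. *)
rewrite !exprMn t2 r2 /x.
have -> : alpha ^+ 2 * (rho ^+ 2) ^+ 2 * (2 ^+ 28 * D * (alpha * rho ^+ 2)^-1 ^+ 2) =
    2 ^+ 28 * D by field; rewrite !gt_eqF.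
lra.
Qed.
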